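(* Let $X$ be the toric Fano variety given by a polytope $P\subset\mathbb{R}^n$ (the dual of a Fano polytope). Let $\phi_0\in\mathrm{PSH}_b(P)$, let $f\in L^1(P)$ be a convex function, and let $\phi_t=(\phi_0^*+tf)^*\in\mathcal{E}^1(P)$, $t\ge 0$, be the associated toric geodesic ray with finite energy. Then the limit slope of the Ding functional $D$ along this ray is $$\lim_{t\to\infty}\frac1t D(\phi_t)=-f(0)+\frac{1}{V_P}\int_P f\,dy .$$
   Context: Let $N$ be a lattice of rank $n$ with dual lattice $M$, and identify $N_{\mathbb R}\cong\mathbb R^n$, $M_{\mathbb R}\cong\mathbb R^n$. A Fano polytope is a polytope $Q\subset N_{\mathbb R}$ with $0\in\mathrm{Int}(Q)$ all of whose vertices $q_\alpha$ ($\alpha\in\Lambda$) are primitive elements of $N$. Its dual polytope is $P=\{y\in M_{\mathbb R}\mid \langle q_\alpha,y\rangle+1\ge 0\ \forall\alpha\in\Lambda\}$, which contains $0$ in its interior. The toric Fano variety given by $P$ is the toric variety of the fan spanned by the proper faces of $Q$. $V_P$ is the Lebesgue volume of $P$ and $dy$ is Lebesgue measure. $\psi_P(x)=\sup_{y\in P}\langle x,y\rangle$ is the support function of $P$. The Legendre dual of $\phi:\mathbb R^n\to\mathbb R$ is $\phi^*(y)=\sup_{x\in\mathbb{R}^n}(\langle x,y\rangle-\phi(x))$; likewise, for a function $u$ on $\mathrm{Int}(P)$, $u^*(x)=\sup_{y}(\langle x,y\rangle-u(y))$, the supremum over $y\in\mathrm{Int}(P)$. $\mathrm{PSH}(P)=\{\phi:\mathbb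 R^n\to\mathbb R\text{ convex}\mid \phi\le\psi_P+C\text{ on }\mathbb R^n\text{ for some }C\}$; $\mathrm{PSH}_b(P)=\{\phi\in\mathrm{PSH}(P)\mid \phi\ge\psi_P-C\text{ for some }C\}$; $\mathcal E^1(P)=\{\phi\in\mathrm{PSH}(P)\mid\int_P\phi^*dy<\infty\}$. These correspond to torus-invariant psh (resp. bounded psh, finite energy psh) metrics on $-K_X$. A convex function $f\in L^1(P)$ that generates a toric geodesic ray is a convex function $f:\mathrm{Int}(P)\to\mathbb R$ integrable over $P$. On $\mathcal E^1(P)$ the Ding functional is $$D(\phi)=\frac1{V_P}\int_P\phi^*\,dy-\log\int_{\mathbb R^n}e^{-\phi}\,dx .$$ *)

(* Defs.v *)
From HB Require Import structures.
From mathcomp Require Import all_boot all_order all_algebra.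
From mathcomp Require Import all_classical all_reals all_analysis.

Set Implicit Arguments.
Unset Strict Implicit.
Unset Printing Implicit Defensive.

Import Order.TTheory GRing.Theory Num.Theory.
Import numFieldNormedType.Exports.

Local Open Scope classical_set_scope.
Local Open Scope ring_scope.

Definition measure_rV_display : measure_display.
Proof. exact: default_measure_display. Qed.

Section measurable_rV.
Context {R : realType} {n : nat}.

Definition rV_coord (i : 'I_n) (x : 'rV[R]_n) : measurableTypeR R := x ord0 i.

Let rV_set0 : g_sigma_preimage rV_coord set0.
Proof. exact: sigma_algebra0. Qed.

Let rV_setC A : g_sigma_preimage rV_coord A ->
  g_sigma_preimage rV_coord (~` A).
Proof. exact: sigma_algebraC. Qed.

Let rV_bigcup (F : _^nat) : (forall i, g_sigma_preimage rV_coord (F i)) ->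
  g_sigma_preimage rV_coord (\bigcup_i (F i)).
Proof. exact: sigma_algebra_bigcup. Qed.

(* The product sigma-algebra on R^n, that is, its Borel sigma-algebra. *)
HB.instance Definition _ := @isMeasurable.Build measure_rV_display
  'rV[R]_n (g_sigma_preimage rV_coord) rV_set0 rV_setC rV_bigcup.

Lemma measurable_rV_coord (i : 'I_n) : measurable_fun setT (rV_coord i).
Proof.
move=> _ Y mY; rewrite setTI; apply: sub_sigma_algebra => /=.
rewrite -bigcup_seq/=; exists i => /=; first by rewrite mem_index_enum.
by exists Y => //; rewrite setTI.
Qed.

Lemma measurable_fun_rV d (T : measurableType d) (f : T -> 'rV[R]_n) :
  (forall i, measurable_fun setT (rV_coord i \o f)) -> measurable_fun setT f.
Proof.
move=> mf _ A mA; rewrite setTI.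
suff: g_sigma_preimage (fun i => rV_coord i \o f) `<=` measurable.
  apply; rewrite g_sigma_preimage_comp.
  by exists A => //; rewrite setTI.
apply: smallest_sub; first exact: sigma_algebra_measurable.
rewrite -bigcup_seq => B [i /= _ [C mC <-]].
exact: mf.
Qed.

End measurable_rV.

Section lebesgue_rV.
Context (R : realType).

Definition rV_cons n (p : measurableTypeR R * 'rV[R]_n) : 'rV[R]_n.+1 :=
  \row_i (if unlift ord0 i is Some j then p.2 ord0 j else p.1).

Definition rV_uncons n (x : 'rV[R]_n.+1) : measurableTypeR R * 'rV[R]_n :=
  (x ord0 ord0, \row_j x ord0 (lift ord0 j)).

Lemma rV_consK n : cancel (@rV_cons n) (@rV_uncons n).
Proof.
move=> [a x]; rewrite /rV_cons /rV_uncons mxE unlift_none; congr (_, _).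
by apply/rowP => j; rewrite !mxE liftK.
Qed.

Lemma rV_unconsK n : cancel (@rV_uncons n) (@rV_cons n).
Proof.
by move=> x; apply/rowP => i; rewrite mxE; case: unliftP => [j|] ->; rewrite ?mxE.
Qed.

Lemma measurable_rV_cons n : measurable_fun setT (@rV_cons n).
Proof.
apply: measurable_fun_rV => i.
case: (unliftP ord0 i) => [j|] ->.
  rewrite (_ : _ \o _ = rV_coord j \o snd); last first.
    by apply/funext => p /=; rewrite /rV_coord mxE liftK.
  by apply: measurableT_comp => //; exact: measurable_rV_coord.
rewrite (_ : _ \o _ = fst)//.
by apply/funext => p /=; rewrite /rV_coord mxE unlift_none.
Qed.

Lemma measurable_rV_uncons n : measurable_fun setT (@rV_uncons n).
Proof.
apply: measurable_fun_pair; first exact: measurable_rV_coord.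
apply: measurable_fun_rV => j.
rewrite (_ : _ \o _ = rV_coord (lift ord0 j)); first exact: measurable_rV_coord.
by apply/funext => x /=; rewrite /rV_coord mxE.
Qed.

Section step.
Local Open Scope ereal_scope.
Context n (m : {sigma_finite_measure set 'rV[R]_n -> \bar R}).

Definition lebesgue_rV_step : set 'rV[R]_n.+1 -> \bar R :=
  pushforward (@lebesgue_measure R \x m) (@rV_cons n).

Let step0 : lebesgue_rV_step set0 = 0.
Proof. by rewrite /lebesgue_rV_step /pushforward preimage_set0 measure0. Qed.

Let step_ge0 A : 0 <= lebesgue_rV_step A.
Proof. by rewrite /lebesgue_rV_step /pushforward measure_ge0. Qed.

Let step_sigma_additive : semi_sigma_additive lebesgue_rV_step.
Proof.
have mcons A : measurable A -> measurable (@rV_cons n @^-1` A).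
  by move=> mA; rewrite -[X in measurable X]setTI; exact: measurable_rV_cons.
move=> F mF tF mUF; rewrite /lebesgue_rV_step /pushforward preimage_bigcup.
apply: measure_semi_sigma_additive.
- by move=> k; exact: mcons.
- apply/trivIsetP => /= i j _ _ ij; rewrite -preimage_setI.
  by move/trivIsetP : tF => /(_ _ _ _ _ ij) ->//; rewrite preimage_set0.
- by rewrite -preimage_bigcup; exact: mcons.
Qed.

HB.instance Definition _ := isMeasure.Build _ _ _ lebesgue_rV_step
  step0 step_ge0 step_sigma_additive.

Let step_sigma_finite : sigma_finite setT lebesgue_rV_step.
Proof.
have /sigma_finiteP[F [TF ndF Foo]] := sigma_finiteT (@lebesgue_measure R).
have /sigma_finiteP[G [TG ndG Goo]] := sigma_finiteT m.
exists (fun k => @rV_uncons n @^-1` (F k `*` G k)).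
  rewrite -preimage_bigcup (_ : \bigcup_k _ = setT) ?preimage_setT//.
  rewrite -setXTT TF TG; apply/seteqP; split=> -[x y].
    by move=> [k _ [Fx Gy]]; split; exists k.
  move=> [/= [i _ Fx] [j _ Gy]]; exists (maxn i j) => //; split.
  - by move: x Fx; exact/subsetPset/ndF/leq_maxl.
  - by move: y Gy; exact/subsetPset/ndG/leq_maxr.
move=> k; have [mF Fk] := Foo k; have [mG Gk] := Goo k; split.
  rewrite -[X in measurable X]setTI; apply: measurable_rV_uncons => //.
  exact: measurableX.
rewrite /lebesgue_rV_step /pushforward -comp_preimage.
rewrite (_ : _ \o _ = id) ?preimage_id; last first.
  by apply/funext => p /=; rewrite rV_consK.
by rewrite product_measure1E// lte_mul_pinfty// ge0_fin_numE.
Qed.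

HB.instance Definition _ := Measure_isSigmaFinite.Build _ _ _ lebesgue_rV_step
  step_sigma_finite.

End step.

(* Lebesgue measure on R^n as the n-fold product of Lebesgue measure on R; see
   lebesgue_rV_box. *)
Fixpoint lebesgue_rV n : {sigma_finite_measure set 'rV[R]_n -> \bar R} :=
  match n with
  | 0 => \d_(0 : 'rV[R]_0)
  | n'.+1 => lebesgue_rV_step (lebesgue_rV n')
  end.

Lemma lebesgue_rV_box n (A : 'I_n -> set (measurableTypeR R)) :
  (forall i, measurable (A i)) ->
  lebesgue_rV n [set x : 'rV[R]_n | forall i, A i (x ord0 i)] =
  (\prod_(i < n) lebesgue_measure (A i))%E.
Proof.
elim: n A => [|n IH] A mA.
  by rewrite big_ord0 /= diracE mem_set// => -[].
rewrite big_ord_recl -IH// /= /lebesgue_rV_step /pushforward.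
rewrite -product_measure1E//; last first.
  rewrite (_ : mkset _ = \bigcap_(i in [set: 'I_n])
      (setT `&` rV_coord i @^-1` A (lift ord0 i))); last first.
    by apply/seteqP; split=> x /= + i; [split => //|move=> /(_ i I) []].
  apply: fin_bigcap_measurable; first exact: finite_finset.
  by move=> i _; exact: measurable_rV_coord.
congr (_ _); apply/seteqP; split => [[a x]/= Ax|[a x]/= [Aa Ax] i].
  split=> [|i]; first by have := Ax ord0; rewrite mxE unlift_none.
  by have := Ax (lift ord0 i); rewrite mxE liftK.
by rewrite mxE; case: unliftP => [j|] ->.
Qed.

End lebesgue_rV.

Section fano.
Context {R : realType} {n : nat}.
Implicit Types (x y : 'rV[R]_n) (P Q D : set 'rV[R]_n).

Definition pairing x y : R := \sum_(i < n) x ord0 i * y ord0 i.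

Definition polytope Q : Prop :=
  exists2 V : set 'rV[R]_n, finite_set V & Q = smallest (@convex_set R _) V.

Definition vertex Q x : Prop :=
  Q x /\ forall y z (t : {i01 R}), Q y -> Q z -> 0 < t%:num < 1 ->
    x = t%:num *: y + (1 - t%:num) *: z -> y = x /\ z = x.

(* This excludes z = 0, as 0 = 0 *+ 0. *)
Definition primitive (z : 'rV[int]_n) : Prop :=
  forall (w : 'rV[int]_n) (k : nat), z = w *+ k -> k = 1%N.

(* The lattice is Z^n inside R^n. *)
Definition fano_polytope Q : Prop :=
  [/\ polytope Q, Q° 0 &
      forall q, vertex Q q -> exists2 z, primitive z & q = map_mx intr z].

Definition dual_polytope Q : set 'rV[R]_n :=
  [set y | forall q, vertex Q q -> 0 <= pairing q y + 1].

Local Open Scope ereal_scope.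

Definition support_fun P x : \bar R := ereal_sup [set (pairing x y)%:E | y in P].

Definition legendre D (u : 'rV[R]_n -> \bar R) x : \bar R :=
  ereal_sup [set (pairing x y)%:E - u y | y in D].

Definition conjugate (phi : 'rV[R]_n -> R) : 'rV[R]_n -> \bar R :=
  legendre setT (EFin \o phi).

Definition PSH P (phi : 'rV[R]_n -> R) : Prop :=
  convex_function setT phi /\
  exists C : R, forall x, (phi x)%:E <= support_fun P x + C%:E.

Definition PSHb P (phi : 'rV[R]_n -> R) : Prop :=
  PSH P phi /\ exists C : R, forall x, support_fun P x - C%:E <= (phi x)%:E.

Definition finite_energy P (phi : 'rV[R]_n -> R) : Prop :=
  PSH P phi /\ \int[lebesgue_rV R n]_(y in P) conjugate phi y < +oo.

Definition volume P : R := fine (lebesgue_rV R n P).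

Definition ding P (phi : 'rV[R]_n -> R) : \bar R :=
  ((volume P)^-1)%:E * \int[lebesgue_rV R n]_(y in P) conjugate phi y
  - lne (\int[lebesgue_rV R n]_x (expR (- phi x))%:E).

(* f is only meaningful on the interior of P, and the outer Legendre dual is
   that of a function on the interior. *)
Definition toric_ray P (phi0 f : 'rV[R]_n -> R) (t : R) : 'rV[R]_n -> \bar R :=
  legendre P° (fun y => conjugate phi0 y + (t * f y)%:E).

End fano.

(* Main.v *)
Require Import Defs.
From HB Require Import structures.
From mathcomp Require Import all_boot all_order all_algebra.
From mathcomp Require Import all_classical all_reals all_analysis.
From mathcomp Require Import measurable_realfun exponential_distribution.
From mathcomp Require Import ring lra.

(** Write v for the Legendre dual of phi0 and u_t = v + t f on the interior I
    of P, so that phi_t is the Legendre dual of u_t.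

    Since phi0 >= psi_P - C, where psi_P is the support function of P, the
    function psi_P is finite, so that P is bounded ([support_finite_bounded]),
    and v is bounded on P ([conjugate_bounded]).

    The energy term. The function u_t is convex on the open convex set I, so
    it has a subgradient at each point of I ([subgradient]) and therefore is
    its own biconjugate there ([biconjugate]): the dual of phi_t is u_t on I.
    P is cut out by finitely many half-spaces, because the vertices of a convex
    hull of a finite set V lie in V ([vertex_hull]); so P \ I is contained in
    finitely many hyperplanes and is a null set ([polar_boundary_null]). The
    energy is thus the integral of v plus t times the integral of f.

    The logarithmic term. It remains to see that the logarithm of the integral
    of exp(-phi_t) grows like t f(0).
    - From below ([ray_integral_ge]): a subgradient a of f at 0 gives
      phi_t(x) <= psi_P(x - t a) - t f(0) + k, and the right-hand side is
      - t f(0) + O(1) on a unit cube at t a, which has volume 1.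
    - From above ([ray_integral_le]): evaluating the supremum that defines
      phi_t at the vertices of a small cube centred at 0 gives
      phi_t(x) >= c |x|_1 - t (f(0) + eta) - C, where eta > 0 is arbitrary and
      c > 0 depends on eta only; and exp(- c |x|_1) is integrable.
    Dividing by t and letting t go to infinity, then eta to 0, gives the slope
    ([slope_limit]). *)

Set Implicit Arguments.
Unset Strict Implicit.
Unset Printing Implicit Defensive.

Import Order.TTheory GRing.Theory Num.Theory.
Import numFieldNormedType.Exports.
Local Open Scope classical_set_scope.
Local Open Scope ring_scope.

(** * Pairing and Borel sets of R^n *)

Section pairing_borel.
Context {R : realType} {n : nat}.
Implicit Types (x y z : 'rV[R]_n).

Lemma pairingC x y : pairing x y = pairing y x.
Proof. by apply: eq_bigr => i _; rewrite mulrC. Qed.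

Lemma pairingDr x y z : pairing x (y + z) = pairing x y + pairing x z.
Proof. by rewrite -big_split; apply: eq_bigr => i _; rewrite mxE mulrDr. Qed.

Lemma pairingZr k x y : pairing x (k *: y) = k * pairing x y.
Proof. by rewrite mulr_sumr; apply: eq_bigr => i _; rewrite mxE mulrCA. Qed.

Lemma pairing0r x : pairing x 0 = 0.
Proof. by rewrite -(scale0r (0 : 'rV_n)) pairingZr mul0r. Qed.

Lemma pairingNr x y : pairing x (- y) = - pairing x y.
Proof. by rewrite -scaleN1r pairingZr mulN1r. Qed.

Lemma pairingBr x y z : pairing x (y - z) = pairing x y - pairing x z.
Proof. by rewrite pairingDr pairingNr. Qed.

Lemma pairing_delta x i : pairing x (delta_mx ord0 i) = x ord0 i.
Proof.
rewrite /pairing (bigD1 i)//= mxE !eqxx mulr1 big1 ?addr0// => j ji.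
by rewrite mxE eqxx/= (negbTE ji) mulr0.
Qed.

Lemma pairing_bound x y a b :
  (forall i, `|x ord0 i| <= a) -> (forall i, `|y ord0 i| <= b) ->
  `|pairing x y| <= n%:R * (a * b).
Proof.
move=> xa yb; apply: le_trans (ler_norm_sum _ _ _) _.
apply: (le_trans (y := \sum_(i < n) a * b)); last first.
  by rewrite sumr_const card_ord mulr_natl.
by apply: ler_sum => i _; rewrite normrM ler_pM.
Qed.

Lemma ball_rV x e y : 0 < e ->
  ball x e y <-> forall i, `|x ord0 i - y ord0 i| < e.
Proof.
move=> e0; split=> [[_ xy] i|xy]; first exact: xy.
by split => // i j; rewrite ord1; exact: xy.
Qed.

Lemma open_halfspace x c : open [set y | c < pairing x y].
Proof.
have [m [m0 xm]] : exists m, 0 < m /\ forall i, `|x ord0 i| <= m.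
  exists (1 + \sum_i `|x ord0 i|); split; first by rewrite ltr_wpDr// sumr_ge0.
  by move=> i; rewrite ler_wpDl// (bigD1 i)//= lerDl sumr_ge0.
rewrite openE => y /= cy; apply/nbhs_ballP.
pose e := (pairing x y - c) / ((n%:R + 1) * m).
have n0 : 0 < (n%:R + 1 : R) by rewrite ltr_wpDl.
have e0 : 0 < e by rewrite divr_gt0 ?subr_gt0// mulr_gt0.
exists e => //= z /(ball_rV _ _ e0) yz.
have : `|pairing x (y - z)| <= n%:R * (m * e).
  by apply: pairing_bound => // i; rewrite !mxE ltW.
rewrite pairingBr => /ler_normlP[_].
have : n%:R * (m * e) < pairing x y - c.
  rewrite /e (_ : n%:R * _ = (pairing x y - c) * (n%:R / (n%:R + 1))); last first.
    by field; rewrite !gt_eqF.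
  by rewrite gtr_pMr ?subr_gt0// ltr_pdivrMr// mul1r ltrDl.
by move=> h1 /le_lt_trans/(_ h1); rewrite ltrD2l ltrN2.
Qed.

Lemma measurable_box (A : 'I_n -> set (measurableTypeR R)) :
  (forall i, measurable (A i)) ->
  measurable [set x : 'rV[R]_n | forall i, A i (x ord0 i)].
Proof.
move=> mA; rewrite (_ : mkset _ =
    \bigcap_(i in [set: 'I_n]) (setT `&` @rV_coord R n i @^-1` A i)).
  apply: fin_bigcap_measurable; first exact: finite_finset.
  by move=> i _; exact: measurable_rV_coord.
apply/seteqP; split=> [x Ax i _|x Ax i]; last by have [] := Ax i Logic.I.
by split => //=; exact: Ax.
Qed.

(** The sigma-algebra generated by the coordinates contains the open sets
    because these are countable unions of cubes with rational data. *)
Lemma open_measurable_rV (A : set 'rV[R]_n) : open A -> measurable A.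
Proof.
move=> oA.
pose box (p : 'rV[rat]_n * rat) : set 'rV[R]_n :=
  [set x | forall i, ball (ratr (p.1 ord0 i) : R^o) (ratr p.2) (x ord0 i)].
have mbox p : measurable (box p).
  apply: (@measurable_box (fun i => ball (ratr (p.1 ord0 i) : R^o) (ratr p.2))).
  by move=> i; rewrite ball_itv; exact: measurable_itv.
rewrite (_ : A = \bigcup_p (if `[< box p `<=` A >] then box p else set0)).
  by apply: countable_bigcupT_measurable => // p; case: ifP.
apply/seteqP; split => [x Ax|x [p _]]; last by case: ifPn => // /asboolP; exact.
have /nbhs_ballP[e /= e0 xeA] := open_nbhs_nbhs (conj oA Ax).
have [r] := @rat_in_itvoo R 0 (e / 2) (divr_gt0 e0 (ltr0Sn _ _)).
rewrite in_itv/= => /andP[r0 re].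
have /choice[q xq] : forall i, exists q : rat, `|ratr q - x ord0 i| < ratr r.
  move=> i; have /rat_in_itvoo[q] : x ord0 i - ratr r < x ord0 i + ratr r.
    by rewrite ltrD2l gtrN.
  rewrite in_itv/= => /andP[q1 q2]; exists q.
  by rewrite ltr_norml; apply/andP; split; lra.
have xb : box (\row_i q i, r) x by move=> i; rewrite /= mxE; exact: xq.
exists (\row_i q i, r) => //; case: ifPn => // /asboolPn; elim=> y /= yb.
apply: xeA; apply/ball_rV => // i.
have := yb i; have := xb i; rewrite /ball/= mxE !ltr_norml.
move=> /andP[? ?] /andP[? ?]; apply/andP; split; lra.
Qed.

Lemma measurable_hyperplane (q : 'rV[R]_n) (c : R) :
  measurable [set y | pairing q y = c].
Proof.
have mH q' r : measurable [set y : 'rV[R]_n | r < pairing q' y].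
  by apply: open_measurable_rV; exact: open_halfspace.
rewrite (_ : mkset _ = ~` ([set y | c < pairing q y] `|`
   [set y | - c < pairing (- q) y])).
  by apply: measurableC; apply: measurableU; exact: mH.
apply/seteqP; split => y /=; rewrite (pairingC (- q)) pairingNr ltrN2 (pairingC y).
  by move=> ->; rewrite ltxx => -[].
move=> /not_orP[/negP + /negP]; rewrite -!leNgt => ? ?.
by apply/eqP; rewrite eq_le; apply/andP.
Qed.

Lemma bounded_finite_measure (D : set 'rV[R]_n) (B : R) : measurable D ->
  (forall y, D y -> forall i, `|y ord0 i| <= B) -> (lebesgue_rV R n D < +oo)%E.
Proof.
move=> mD hB; pose J (i : 'I_n) : set (measurableTypeR R) := `[- B, B]%classic.
pose K := [set x : 'rV[R]_n | forall i, J i (x ord0 i)].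
have mJ i : measurable (J i) by exact: measurable_itv.
apply: (@le_lt_trans _ _ (lebesgue_rV R n K)).
  apply: le_measure; rewrite ?inE//; first exact: measurable_box.
  by move=> y Dy i; rewrite /J/= in_itv/= -ler_norml; exact: hB.
rewrite lebesgue_rV_box//.
have Jfin i : lebesgue_measure (J i) \is a fin_num.
  by rewrite lebesgue_measure_itv; case: ifP.
rewrite (_ : (\prod_(i < n) _)%E = (\prod_(i < n) fine (lebesgue_measure (J i)))%:E).
  exact: ltry.
by rewrite -prodEFin; apply: eq_bigr => i _; rewrite fineK.
Qed.

End pairing_borel.

(** * Integration over R^n *)

Section integration.
Context {R : realType}.
Local Open Scope ereal_scope.
Notation mu := (@lebesgue_measure R).

Lemma integral_rV_cons n (g : 'rV[R]_n.+1 -> \bar R) :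
  measurable_fun setT g -> (forall x, 0 <= g x) ->
  \int[lebesgue_rV R n.+1]_x g x =
  \int[mu \x lebesgue_rV R n]_p g (rV_cons p).
Proof.
move=> mg g0.
by rewrite (ge0_integral_pushforward (@measurable_rV_cons R n)).
Qed.

Lemma integral_expR_abs (c : R) : (0 < c)%R ->
  \int[mu]_x (expR (- c * `|x|))%:E < +oo.
Proof.
move=> c0.
have cE : continuous (fun x : R => expR (- c * `|x|)).
  move=> x; apply: continuous_comp; last exact: continuous_expR.
  by apply: continuousM; [exact: cst_continuous|exact: norm_continuous].
rewrite ge0_symfun_integralT//; last by move=> x /=; rewrite normrN.
rewrite lte_mul_pinfty//.
(* On the half-line this is the exponential density, up to the factor c. *)
have -> : \int[mu]_(x in [set x | (0 <= x)%R]) (expR (- c * `|x|))%:E =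
   \int[mu]_(x in [set x | (0 <= x)%R]) (c^-1%:E * (exponential_pdf c x)%:E).
  apply: eq_integral => x; rewrite inE/= => x0.
  by rewrite exponential_pdfE// ger0_norm// -EFinM mulKf// gt_eqF.
have mpos : measurable [set x : R | 0 <= x]%R by rewrite -set_itvcy.
have mpdf : measurable_fun setT (EFin \o exponential_pdf c).
  by apply/measurable_EFinP; exact: measurable_exponential_pdf.
rewrite ge0_integralZl//; last 3 first.
- exact: measurable_funTS.
- by move=> x _; rewrite lee_fin exponential_pdf_ge0// ltW.
- by rewrite lee_fin invr_ge0 ltW.
rewrite lte_mul_pinfty// ?lee_fin ?invr_ge0 ?ltW//.
apply: (@le_lt_trans _ _ (\int[mu]_x (exponential_pdf c x)%:E)); last first.
  by rewrite integral_exponential_pdf ?ltW// ltry.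
apply: ge0_subset_integral => //.
by move=> x _; rewrite lee_fin exponential_pdf_ge0// ltW.
Qed.

Lemma measurable_norm1 n :
  measurable_fun setT (fun x : 'rV[R]_n => \sum_i `|x ord0 i|)%R.
Proof.
apply: (@measurable_sum _ _ R setT _ _
  (fun i (x : 'rV[R]_n) => `|x ord0 i|%R)) => i.
apply: (@measurableT_comp _ _ _ _ _ _ (fun z : R => `|z|%R) _
  (@rV_coord R n i)) => //.
exact: measurable_rV_coord.
Qed.

Lemma measurable_expR_norm1 n (c : R) :
  measurable_fun setT (fun x : 'rV[R]_n => (expR (- c * \sum_i `|x ord0 i|))%:E).
Proof.
apply/measurable_EFinP; apply: measurableT_comp => //.
by apply: measurable_funM => //; exact: measurable_norm1.
Qed.

(** The integrand is a product over the coordinates, so by Tonelli the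
    integral is a power of the one-dimensional one. *)
Lemma integral_expR_norm1 n (c : R) : (0 < c)%R ->
  \int[lebesgue_rV R n]_x (expR (- c * \sum_i `|x ord0 i|))%:E < +oo.
Proof.
move=> c0; elim: n => [|n IH].
  rewrite integral_dirac//; last exact: measurable_expR_norm1.
  by rewrite diracE mem_set// mul1e ltry.
rewrite integral_rV_cons//; last exact: measurable_expR_norm1.
rewrite fubini_tonelli1//; last first.
  apply: (@measurableT_comp _ _ _ _ _ _
    (fun x : 'rV[R]_n.+1 => (expR (- c * \sum_i `|x ord0 i|))%:E) _
    (@rV_cons R n)).
    exact: measurable_expR_norm1.
  exact: measurable_rV_cons.
have K0 : 0 <= \int[lebesgue_rV R n]_x (expR (- c * \sum_i `|x ord0 i|))%:E.
  by apply: integral_ge0 => x _; rewrite lee_fin expR_ge0.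
rewrite /fubini_F.
under eq_integral => a _.
  under eq_integral => y _.
    rewrite big_ord_recl mxE unlift_none/=.
    under eq_bigr do rewrite mxE liftK/=.
    rewrite mulrDr expRD EFinM; over.
  rewrite ge0_integralZl//=; last exact: measurable_expR_norm1.
  over.
rewrite ge0_integralZr//.
- rewrite -[X in _ * X](@fineK _) ?ge0_fin_numE//.
  rewrite muleC lte_mul_pinfty//; last exact: integral_expR_abs.
  by rewrite fineK// ge0_fin_numE.
- apply/measurable_EFinP; apply: measurableT_comp => //.
  by apply: measurable_funM.
Qed.

Lemma measure_int_indic d (T : measurableType d)
    (m : {measure set T -> \bar R}) (A : set T) : measurable A ->
  m A = \int[m]_x (\1_A x)%:E.
Proof. by move=> mA; rewrite integral_indic// setIT. Qed.

(** By Tonelli, integrating first over the coordinate 0 if q has a nonzero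
    coefficient there (the slices are points), and otherwise first over the
    other coordinates (the slices are hyperplanes). *)
Lemma hyperplane_null n (q : 'rV[R]_n) (c : R) : q != 0%R ->
  lebesgue_rV R n [set y | pairing q y = c] = 0.
Proof.
elim: n q c => [|n IH] q c q0; first by move: q0; rewrite thinmx0 eqxx.
have mH := measurable_hyperplane q c.
have mI : measurable_fun setT
    (fun x => (\1_[set y | pairing q y = c] x)%:E : \bar R).
  by apply/measurable_EFinP; exact: measurable_indic.
have mI' : measurable_fun setT
    (fun p => (\1_[set y | pairing q y = c] (@rV_cons R n p))%:E : \bar R).
  by apply: (measurableT_comp mI); exact: measurable_rV_cons.
rewrite measure_int_indic// integral_rV_cons//.
pose q' : 'rV[R]_n := \row_j q ord0 (lift ord0 j).
have pq p : pairing q (@rV_cons R n p) =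
    (q ord0 ord0 * p.1 + pairing q' p.2)%R.
  rewrite /pairing big_ord_recl mxE unlift_none; congr (_ + _)%R.
  by apply: eq_bigr => i _; rewrite !mxE liftK.
have [q00|q00] := eqVneq (q ord0 ord0) 0%R.
  have q'0 : q' != 0%R.
    apply: contra q0 => /eqP q'0; apply/eqP/rowP => i; rewrite mxE.
    case: (unliftP ord0 i) => [j|] ->//.
    by have := congr1 (fun z : 'rV[R]_n => z ord0 j) q'0; rewrite !mxE.
  rewrite fubini_tonelli1//.
  apply: integral0_eq => a _; rewrite /fubini_F.
  rewrite -(IH q' c q'0) [RHS]measure_int_indic; last exact: measurable_hyperplane.
  apply: eq_integral => y _; rewrite !indicE; congr ((nat_of_bool _)%:R)%:E.
  by apply/idP/idP; rewrite !inE/= pq q00 mul0r add0r.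
rewrite fubini_tonelli2//.
apply: integral0_eq => y _; rewrite /fubini_G.
rewrite -(lebesgue_measure_set1 ((c - pairing q' y) / q ord0 ord0)).
rewrite [RHS]measure_int_indic//.
apply: eq_integral => a _; rewrite !indicE; congr ((nat_of_bool _)%:R)%:E.
apply/idP/idP; rewrite !inE/= pq/=.
  by move=> <-; rewrite addrK mulrC mulKf.
by move=> ->; rewrite mulrC divfK// subrK.
Qed.

Lemma integral_setD_null d (T : measurableType d)
    (m : {measure set T -> \bar R}) (A B : set T) (g : T -> \bar R) :
  measurable A -> measurable B -> A `<=` B -> measurable_fun B g ->
  m.-negligible (B `\` A) ->
  \int[m]_(x in B) g x = \int[m]_(x in A) g x.
Proof.
move=> mA mB AB mg nBA.
have mBA : measurable (B `\` A) by exact: measurableD.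
rewrite -{1}(setDUK AB) integral_setU//; last 2 first.
- by rewrite setDUK.
- by apply/disj_setPS => x [Ax []].
rewrite [X in (_ + X)%E]null_set_integral ?adde0//.
- by apply: measurable_funS mg => // x [].
- exact/negligibleP.
Qed.

Lemma measurable_expRN n (g : 'rV[R]_n -> R) : measurable_fun setT g ->
  measurable_fun setT (fun x => (expR (- g x))%:E).
Proof.
move=> mg; apply/measurable_EFinP; apply: measurableT_comp => //.
exact: measurable_funN.
Qed.

(** The cube has volume 1, so the value of the integrand on it suffices. *)
Lemma integral_expRN_ge n (g : 'rV[R]_n -> R) (a : 'rV[R]_n) (c : R) :
  measurable_fun setT g ->
  (forall x : 'rV[R]_n,
    (forall i, (a ord0 i <= x ord0 i <= a ord0 i + 1)%R) -> (g x <= c)%R) ->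
  (expR (- c))%:E <= \int[lebesgue_rV R n]_x (expR (- g x))%:E.
Proof.
move=> mg gc.
pose J (i : 'I_n) : set (measurableTypeR R) :=
  `[a ord0 i, (a ord0 i + 1)%R]%classic.
pose K := [set x : 'rV[R]_n | forall i, J i (x ord0 i)].
have mJ i : measurable (J i) by exact: measurable_itv.
have mK : measurable K by exact: measurable_box.
have K1 : lebesgue_rV R n K = 1.
  rewrite lebesgue_rV_box//; apply: big1 => i _.
  rewrite lebesgue_measure_itv/= lte_fin ltrDl ltr01.
  by rewrite -EFinB addrAC subrr add0r.
apply: (@le_trans _ _ (\int[lebesgue_rV R n]_(x in K) (expR (- g x))%:E)); last first.
  by apply: ge0_subset_integral => //; exact: measurable_expRN.
rewrite -[X in X <= _]mule1 -K1 -integral_cst//.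
apply: ge0_le_integral => //.
- by move=> x _; rewrite lee_fin expR_ge0.
- by apply: measurable_funTS; exact: measurable_expRN.
- by move=> x Kx; rewrite lee_fin ler_expR lerN2; apply: gc.
Qed.

Lemma integral_expRN_le n (g : 'rV[R]_n -> R) (c k : R) :
  measurable_fun setT g ->
  (forall x : 'rV[R]_n, (c * \sum_i `|x ord0 i| - k <= g x)%R) ->
  \int[lebesgue_rV R n]_x (expR (- g x))%:E <=
  (expR k)%:E * \int[lebesgue_rV R n]_x (expR (- c * \sum_i `|x ord0 i|))%:E.
Proof.
move=> mg gk; rewrite -ge0_integralZl//; last exact: measurable_expR_norm1.
apply: ge0_le_integral => //.
- exact: measurable_expRN.
- by apply: measurable_funeM; exact: measurable_expR_norm1.
move=> x _; rewrite -EFinM -expRD lee_fin ler_expR mulNr.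
by have := gk x; lra.
Qed.

End integration.

(** * Subgradients of convex functions *)

Section convexity.
Context {R : realType} {n : nat}.
Implicit Types (x y : 'rV[R]_n) (D : set 'rV[R]_n).

Lemma convex_set_comb D x y s r : convex_set D -> D x -> D y -> 0 < s -> 0 < r ->
  D ((s / (s + r)) *: x + (r / (s + r)) *: y).
Proof.
move=> cD Dx Dy s0 r0.
have sr0 : 0 < s + r by rewrite addr_gt0.
have t0 : 0 <= s / (s + r) by rewrite divr_ge0 ?ltW.
have t1 : s / (s + r) <= 1 by rewrite ler_pdivrMr// mul1r lerDl ltW.
have := cD x y (Itv01 t0 t1); rewrite !inE => /(_ Dx Dy).
congr D; congr (_ + _ *: _) => /=; rewrite /unstable.onem/=.
by field; rewrite gt_eqF.
Qed.

Lemma convex_fun_comb D (g : 'rV[R]_n -> R) x y s r :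
  convex_function D g -> D x -> D y -> 0 < s -> 0 < r ->
  g ((s / (s + r)) *: x + (r / (s + r)) *: y) <=
  (s / (s + r)) * g x + (r / (s + r)) * g y.
Proof.
move=> cg Dx Dy s0 r0.
have sr0 : 0 < s + r by rewrite addr_gt0.
have t0 : 0 <= s / (s + r) by rewrite divr_ge0 ?ltW.
have t1 : s / (s + r) <= 1 by rewrite ler_pdivrMr// mul1r lerDl ltW.
have := cg (Itv01 t0 t1) x y; rewrite !inE => /(_ Dx Dy).
rewrite convRE /conv/= /unstable.onem/=.
by rewrite (_ : 1 - s / (s + r) = r / (s + r))//; field; rewrite gt_eqF.
Qed.

Lemma separating_real (A B : set R) : A !=set0 -> B !=set0 ->
  (forall a b, A a -> B b -> a <= b) ->
  exists c, (forall a, A a -> a <= c) /\ (forall b, B b -> c <= b).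
Proof.
move=> A0 [b0 Bb0] AB; exists (sup A); split=> [a Aa|b Bb].
  by apply: ub_le_sup => //; exists b0 => x Ax; exact: AB.
by apply: ge_sup => // a Aa; exact: AB.
Qed.

(** The Hahn-Banach argument in finite dimension: a linear minorant of g at y0
    is built on the directions supported on the first k coordinates, by
    induction on k. Extending it by one coordinate means choosing its slope
    alpha there; convexity says that each slope bound coming from the negative
    side (the set A) is at most each one coming from the positive side (the set
    B), and neither set is empty because y0 is interior. *)
Lemma subgradient D (g : 'rV[R]_n -> R) y0 :
  convex_set D -> convex_function D g -> D° y0 ->
  exists a : 'rV[R]_n, forall y, D y -> g y0 + pairing a (y - y0) <= g y.
Proof.
move=> cD cg intDy0.
have Dy0 : D y0 by exact: interior_subset.
have [d d0 dD] : exists2 d, 0 < d & forall i (s : R), `|s| < d ->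
    D (y0 + s *: delta_mx ord0 i).
  have /nbhs_ballP[d /= d0 dD] := intDy0.
  exists d => // i s sd; apply: dD; apply/ball_rV => // j.
  rewrite !mxE opprD addNKr normrN normrM eqxx/=.
  apply: le_lt_trans sd; rewrite ler_piMr//.
  by case: eqP; rewrite ?normr1 ?normr0.
pose supp k (v : 'rV[R]_n) := forall i : 'I_n, (k <= i)%N -> v ord0 i = 0.
suff /(_ n (leqnn n))[a ha] : forall k, (k <= n)%N ->
    exists a : 'rV[R]_n, forall v, supp k v ->
      D (y0 + v) -> g y0 + pairing a v <= g (y0 + v).
  exists a => y Dy; have := ha (y - y0).
  by rewrite (addrC y0) subrK; apply => // i; rewrite leqNgt ltn_ord.
elim=> [_|k IH kn].
  exists 0 => v v0 _; rewrite (_ : v = 0) ?pairing0r ?addr0//.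
  by apply/rowP => i; rewrite mxE v0.
have [a ha] := IH (ltnW kn).
pose i0 := Ordinal kn; pose e : 'rV[R]_n := delta_mx ord0 i0.
pose A := [set c | exists r w, [/\ 0 < r, supp k w, D (y0 + (w - r *: e)) &
  c = (pairing a w + g y0 - g (y0 + (w - r *: e))) / r]].
pose B := [set c | exists r w, [/\ 0 < r, supp k w, D (y0 + (w + r *: e)) &
  c = (g (y0 + (w + r *: e)) - g y0 - pairing a w) / r]].
have d20 : 0 < d / 2 by rewrite divr_gt0.
have d2d : `|d / 2| < d by rewrite gtr0_norm// ltr_pdivrMr// ltr_pMr// ltr1n.
have supp0 : supp k 0 by move=> i _; rewrite mxE.
have [||b c [r [w [r0 wk Dw ->]]] [s [v [s0 vk Dv ->]]]|alpha [Aalpha Balpha]] :=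
    @separating_real A B.
- eexists; exists (d / 2), 0; split => //.
  by rewrite sub0r -scaleNr; apply: dD; rewrite normrN.
- by eexists; exists (d / 2), 0; split => //; rewrite add0r; apply: dD.
- have sr0 : 0 < s + r by rewrite addr_gt0.
  (* The weights are those for which the coordinate along e cancels. *)
  pose z := (s / (s + r)) *: w + (r / (s + r)) *: v.
  have zE : y0 + z = (s / (s + r)) *: (y0 + (w - r *: e)) +
                     (r / (s + r)) *: (y0 + (v + s *: e)).
    by apply/rowP => i; rewrite !mxE; field; exact: lt0r_neq0.
  have zk : supp k z.
    by move=> i ki; rewrite !mxE wk// vk// !mulr0 addr0.
  have Dz : D (y0 + z) by rewrite zE; exact: convex_set_comb.
  have := ha z zk Dz; rewrite zE => /le_trans/(_ (convex_fun_comb cg Dw Dv s0 r0)).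
  rewrite pairingDr !pairingZr.
  set g1 := g (y0 + (w - _)); set g2 := g (y0 + (v + _)).
  set p1 := pairing a w; set p2 := pairing a v.
  rewrite -(ler_pM2r sr0).
  rewrite [X in X <= _](_ : _ = (s + r) * g y0 + s * p1 + r * p2); last first.
    by field; rewrite lt0r_neq0.
  rewrite [X in _ <= X](_ : _ = s * g1 + r * g2); last by field; rewrite lt0r_neq0.
  by move=> h; rewrite ler_pdivrMr// mulrAC ler_pdivlMr//; lra.
exists (a + (alpha - a ord0 i0) *: e) => v vk Dv.
pose w := v - v ord0 i0 *: e.
have wk : supp k w.
  move=> i; rewrite leq_eqVlt => /predU1P[ki|ki].
    by rewrite (_ : i = i0) ?mxE ?eqxx ?mulr1 ?subrr//; exact/val_inj.
  rewrite !mxE (vk _ ki) (_ : (i == i0) = false) ?andbF ?mulr0 ?subr0//.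
  by apply/negbTE; apply: contraTN ki => /eqP ->; rewrite /= ltnn.
have vE : v = w + v ord0 i0 *: e by rewrite subrK.
have -> : pairing (a + (alpha - a ord0 i0) *: e) v =
   pairing a w + v ord0 i0 * alpha.
  rewrite pairingC pairingDr pairingZr pairing_delta /w pairingBr pairingZr.
  by rewrite pairing_delta (pairingC v); ring.
have [s0|s0|s0] := ltgtP (v ord0 i0) 0.
- have /Aalpha : A ((pairing a w + g y0 - g (y0 + v)) / (- v ord0 i0)).
    by exists (- v ord0 i0), w; rewrite scaleNr opprK -vE oppr_gt0.
  by rewrite ler_pdivrMr ?oppr_gt0//; lra.
- have /Balpha : B ((g (y0 + v) - g y0 - pairing a w) / (v ord0 i0)).
    by exists (v ord0 i0), w; rewrite -vE.
  by rewrite ler_pdivlMr//; lra.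
- have wv : w = v by rewrite /w s0 scale0r subr0.
  by rewrite s0 mul0r addr0 wv; apply: ha => //; rewrite -wv.
Qed.

End convexity.

(** * Legendre duality *)

Section legendre_duality.
Context {R : realType} {n : nat}.
Implicit Types (x y : 'rV[R]_n) (D W P : set 'rV[R]_n) (u : 'rV[R]_n -> \bar R).

(** A supremum of affine functions is lower semicontinuous, whatever the
    function and the set that index it. *)
Lemma measurable_legendre D u : measurable_fun setT (legendre D u).
Proof.
apply: (measurability _ (ErealGenOInfty.measurableE R)) => //.
move=> _ [_ [r ->]] <-; rewrite setTI.
apply: open_measurable_rV.
rewrite (_ : _ @^-1` _ =
  \bigcup_(y in D) [set x | (r%:E < (pairing x y)%:E - u y)%E]).
  apply: bigcup_open => y _.
  case: (u y) => [s||] /=.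
  - rewrite (_ : mkset _ = [set x | r + s < pairing y x]).
      exact: open_halfspace.
    by apply/seteqP; split => x /=; rewrite -EFinB lte_fin pairingC ltrBrDr.
  - by rewrite (_ : mkset _ = set0); [exact: open0|apply/seteqP; split].
  - rewrite (_ : mkset _ = setT); first exact: openT.
    by apply/seteqP; split => // x _ /=; rewrite ltry.
apply/seteqP; split => x /=.
  rewrite in_itv/= andbT => /ereal_sup_gt [_ [y Dy <-] ry].
  by exists y.
move=> [y Dy ry]; rewrite in_itv/= andbT; apply/ereal_sup_gtP.
by eexists; first by exists y.
Qed.

Lemma measurable_fin_legendre D u (g : 'rV[R]_n -> R) :
  (forall x, (g x)%:E = legendre D u x) -> measurable_fun setT g.
Proof.
move=> gE; apply/measurable_EFinP.
rewrite (_ : _ \o _ = legendre D u); first exact: measurable_legendre.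
exact/funext.
Qed.

Lemma legendre_ge D u x y r : D y -> u y = r%:E ->
  ((pairing x y - r)%:E <= legendre D u x)%E.
Proof. by move=> Dy uy; apply: ereal_sup_ubound; exists y => //; rewrite uy. Qed.

Lemma legendre_le D u (w : 'rV[R]_n -> R) x c :
  (forall y, D y -> u y = (w y)%:E) ->
  (forall y, D y -> pairing x y - w y <= c) ->
  (legendre D u x <= c%:E)%E.
Proof.
move=> uw wc; apply: ge_ereal_sup => _ [y Dy <-].
by rewrite uw// -EFinB lee_fin wc.
Qed.

Lemma convex_legendre D u W (v : 'rV[R]_n -> R) :
  (forall y, D y -> u y \is a fin_num) ->
  (forall y, W y -> legendre D u y = (v y)%:E) ->
  convex_set W -> convex_function W v.
Proof.
move=> ufin vE cW t y z yW zW; have := cW y z t yW zW.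
move: yW zW; rewrite !inE => Wy Wz Wyz.
rewrite -lee_fin -vE//.
apply: (@legendre_le _ _ (fine \o u)) => [x Dx|x Dx /=].
  by rewrite /= fineK// ufin.
have ux : u x = (fine (u x))%:E by rewrite fineK// ufin.
have := legendre_ge y Dx ux; rewrite vE// lee_fin => hy.
have := legendre_ge z Dx ux; rewrite vE// lee_fin => hz.
rewrite convRE/= {1}/conv/= pairingC pairingDr !pairingZr !(pairingC x).
rewrite /unstable.onem; set s := t%:num.
have s0 : 0 <= s by rewrite /s ge0.
have s1 : 0 <= 1 - s by rewrite subr_ge0 /s le1.
by have := ler_wpM2l s0 hy; have := ler_wpM2l s1 hz; lra.
Qed.

(** A subgradient a of w at y attains the supremum in the dual of w: the
    dual at a is pairing a y - w y. *)
Lemma biconjugate D (w g : 'rV[R]_n -> R) :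
  open D -> convex_set D -> convex_function D w ->
  (forall x, (g x)%:E = legendre D (EFin \o w) x) ->
  forall y, D y -> conjugate g y = (w y)%:E.
Proof.
move=> oD cD cw gE y Dy; apply/eqP; rewrite eq_le; apply/andP; split.
  apply: (@legendre_le _ _ g) => // x _; rewrite lerBlDr -lerBlDl pairingC.
  by rewrite -lee_fin gE; exact: legendre_ge.
have [|a ha] := @subgradient R n D w y cD cw; first by move: oD; rewrite openE; exact.
apply: (@le_trans _ _ (pairing y a - g a)%:E); last exact: legendre_ge.
rewrite lee_fin lerBrDr -lerBrDl -lee_fin gE.
apply: (@legendre_le _ _ w) => // z Dz.
by have := ha z Dz; rewrite pairingBr (pairingC y); lra.
Qed.

Lemma pairing_le_support P (g : 'rV[R]_n -> R) (C : R) :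
  (forall x, (support_fun P x - C%:E <= (g x)%:E)%E) ->
  forall x y, P y -> pairing x y <= g x + C.
Proof.
move=> hC x y Py; rewrite -lee_fin EFinD -leeBlDr//; apply: le_trans (hC x).
by rewrite leeD2r//; apply: ereal_sup_ubound; exists y.
Qed.

(** Testing the support function on the vectors of the standard basis and
    their opposites bounds the coordinates. *)
Lemma support_finite_bounded P (g : 'rV[R]_n -> R) (C : R) :
  (forall x, (support_fun P x - C%:E <= (g x)%:E)%E) ->
  exists B, forall y, P y -> forall i, `|y ord0 i| <= B.
Proof.
move=> /pairing_le_support hC.
pose b i : R := `|g (delta_mx ord0 i) + C| + `|g (- delta_mx ord0 i) + C|.
exists (\sum_i b i) => y Py i; apply: (@le_trans _ _ (b i)); last first.
  by rewrite (bigD1 i)//= lerDl sumr_ge0// => j _; rewrite addr_ge0.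
have := hC (delta_mx ord0 i) y Py.
have := hC (- delta_mx ord0 i) y Py.
rewrite !(pairingC _ y) pairingNr pairing_delta => h1 h2.
have := ler_norm (g (delta_mx ord0 i) + C).
have := ler_norm (g (- delta_mx ord0 i) + C).
have := normr_ge0 (g (delta_mx ord0 i) + C).
have := normr_ge0 (g (- delta_mx ord0 i) + C).
by rewrite /b => *; rewrite ler_norml; apply/andP; split; lra.
Qed.

Lemma conjugate_bounded P (g : 'rV[R]_n -> R) (C : R) :
  (forall x, (support_fun P x - C%:E <= (g x)%:E)%E) ->
  forall y, P y -> ((- g 0)%:E <= conjugate g y <= C%:E)%E.
Proof.
move=> /pairing_le_support hC y Py; apply/andP; split.
  have := @legendre_ge setT (EFin \o g) y 0 (g 0) I erefl.
  by rewrite pairing0r sub0r.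
apply: (@legendre_le _ _ g) => // x _.
by have := hC x y Py; rewrite pairingC; lra.
Qed.

End legendre_duality.

(** * Dual polytopes *)

Section polytopes.
Context {R : realType} {n : nat}.
Implicit Types (x y q : 'rV[R]_n) (W V Q : set 'rV[R]_n).

Lemma smallest_convex V : convex_set (smallest (@convex_set R _) V).
Proof.
move=> x y t; rewrite !inE => hx hy D [cD VD].
by have := cD x y t; rewrite !inE; apply; [exact: hx|exact: hy].
Qed.

(** Removing an extreme point from the hull leaves a convex set; if the point
    were not in V, that set would still contain V. *)
Lemma vertex_hull V x : vertex (smallest (@convex_set R _) V) x -> V x.
Proof.
set Q := smallest _ _ => -[Qx xext]; apply: contrapT => Vx.
suff QQ : Q `<=` Q `\ x by have [_] := QQ x Qx; apply.
apply: smallest_sub => [|y Vy]; last first.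
  by split; [move=> D [_]; exact|move=> yx; apply: Vx; rewrite -yx].
move=> y z t; rewrite !inE => -[Qy yx] [Qz zx]; split.
  by have := @smallest_convex V y z t; rewrite !inE; exact.
move=> /= tx.
have [t0|t0] := eqVneq t 0%:i01%R; first by apply: zx; rewrite -tx t0 conv0.
have [t1|t1] := eqVneq t 1%:i01%R; first by apply: yx; rewrite -tx t1 conv1.
have [||yE _] := xext y z t Qy Qz; [|by rewrite -tx|exact: yx].
rewrite lt_neqAle eq_sym ge0 andbT lt_neqAle le1 andbT.
by apply/andP; split; [exact: t0|exact: t1].
Qed.

Lemma finite_vertex Q : polytope Q -> finite_set (vertex Q).
Proof. by move=> [V fV ->]; apply: sub_finite_set fV => x; exact: vertex_hull. Qed.

Definition strict_polar W : set 'rV[R]_n :=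
  [set y | forall q, W q -> 0 < pairing q y + 1].

Lemma open_strict_polar W : finite_set W -> open (strict_polar W).
Proof.
move=> /finite_seqP[s ->]; elim: s => [|q s IH].
  rewrite (_ : strict_polar _ = setT); first exact: openT.
  by apply/seteqP; split.
rewrite (_ : strict_polar _ = [set y | - 1 < pairing q y] `&` strict_polar [set` s]).
  by apply: openI => //; exact: open_halfspace.
apply/seteqP; split => y /=.
  move=> h; split => [|r rs]; last by apply: h; rewrite /= inE rs orbT.
  by have := h q; rewrite /= inE eqxx => /(_ isT); lra.
by move=> [h1 h2] r /=; rewrite inE => /predU1P[->|]; [lra|exact: h2].
Qed.

(** Moving from an interior point y a little in the direction - q stays in the
    polar and decreases pairing q y, so the inequality for q is strict at y. *)
Lemma interior_polar W : finite_set W ->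
  [set y | forall q, W q -> 0 <= pairing q y + 1]° = strict_polar W.
Proof.
move=> fW; apply/seteqP; split => [y Py q Wq|]; last first.
  rewrite -open_subsetE; last exact: open_strict_polar.
  by move=> y h q Wq; exact/ltW/h.
have [->|q0] := eqVneq q 0; first by rewrite pairingC pairing0r add0r.
have /nbhs_ballP[e /= e0 ey] := Py.
have S0 : 0 < 1 + \sum_i `|q ord0 i| by rewrite ltr_wpDr// sumr_ge0.
pose s := e / (1 + \sum_i `|q ord0 i|).
have s0 : 0 < s by rewrite divr_gt0.
have /(_ q Wq) : [set y | forall q, W q -> 0 <= pairing q y + 1] (y - s *: q).
  apply: ey; apply/ball_rV => // i.
  rewrite !mxE opprB addrC subrK normrM gtr0_norm//.
  rewrite /s mulrAC ltr_pdivrMr// ltr_pM2l// ltr_pwDl// (bigD1 i)//= lerDl.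
  by rewrite sumr_ge0.
have : 0 < pairing q q.
  rewrite lt_neqAle sumr_ge0 ?andbT; last by move=> i _; rewrite -expr2 sqr_ge0.
  apply: contra q0; rewrite eq_sym psumr_eq0; last first.
    by move=> i _; rewrite -expr2 sqr_ge0.
  move=> /allP h; apply/eqP/rowP => i; rewrite mxE; apply/eqP.
  by have := h i (mem_index_enum _); rewrite mulf_eq0 orbb.
by rewrite pairingBr pairingZr => /(mulr_gt0 s0); lra.
Qed.

Lemma convex_strict_polar W : convex_set (strict_polar W).
Proof.
move=> x y t; rewrite !inE => hx hy q Wq.
rewrite /conv/= pairingDr !pairingZr /unstable.onem.
have := hx q Wq; have := hy q Wq.
set a := pairing q x; set b := pairing q y; set u := t%:num => b0 a0.
have u0 : 0 <= u by rewrite /u ge0.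
have u1 : u <= 1 by rewrite /u le1.
(* One of the two weights u and 1 - u is positive. *)
have [ua|ua] := leP u (1 / 2).
  have : 0 <= u * (a + 1) by rewrite mulr_ge0// ltW.
  have : 0 < (1 - u) * (b + 1) by rewrite mulr_gt0//; lra.
  lra.
have : 0 < u * (a + 1) by rewrite mulr_gt0//; lra.
have : 0 <= (1 - u) * (b + 1) by rewrite mulr_ge0//; [lra|exact: ltW].
lra.
Qed.

(** At a boundary point some inequality is an equality, so the boundary is
    covered by finitely many hyperplanes. *)
Lemma polar_boundary_null W : finite_set W ->
  (lebesgue_rV R n).-negligible
    ([set y | forall q, W q -> 0 <= pairing q y + 1] `\` strict_polar W).
Proof.
move=> /finite_seqP[s ->].
pose H q : set 'rV[R]_n := [set y | (q != 0) && (pairing q y == -1)].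
apply: (@negligibleS _ _ _ _ [set y | has (fun q => `[< H q y >]) s]).
  move=> y [/= h1] /existsNP[q] /not_implyP[/= qs] /negP; rewrite -leNgt => h2.
  apply/hasP; exists q => //; apply/asboolP/andP; split.
    by apply/eqP => q0; move: h2; rewrite q0 pairingC pairing0r; lra.
  by rewrite eq_le; have := h1 q qs; move=> ?; apply/andP; split; lra.
elim: s => [|q s IH]; first by apply: negligibleS (negligible_set0 _).
rewrite (_ : mkset _ = H q `|` [set y | has (fun q => `[< H q y >]) s]); last first.
  apply/seteqP; split => y /= => [/orP[/asboolP|->]|[/asboolP ->|->]]; first by left.
  - by right.
  - by [].
  - by rewrite orbT.
apply: negligibleU => //.
have [->|q0] := eqVneq q 0.
  by apply: negligibleS (negligible_set0 _) => y /=; rewrite /H/= eqxx.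
rewrite (_ : H q = [set y | pairing q y = -1]); last first.
  by rewrite /H q0; apply/seteqP; split => y /= /eqP.
apply/negligibleP; first exact: measurable_hyperplane.
exact: hyperplane_null.
Qed.

Lemma measurable_polar W : finite_set W ->
  measurable [set y | forall q, W q -> 0 <= pairing q y + 1].
Proof.
move=> fW.
rewrite (_ : mkset _ = \bigcap_(q in W) ~` [set y | 1 < pairing (- q) y]).
  apply: fin_bigcap_measurable => // q _; apply: measurableC.
  by apply: open_measurable_rV; exact: open_halfspace.
apply/seteqP; split => y /= h q Wq; have := h q Wq;
  rewrite /= (pairingC (- q)) pairingNr (pairingC y).
  by move=> ?; apply/negP; rewrite -leNgt; lra.
by move=> /negP; rewrite -leNgt; lra.
Qed.

End polytopes.

(** * Growth of the integral of exp (- phi_t) *)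

Section ray_integral.
Context {R : realType} {n : nat}.
Implicit Types (x y : 'rV[R]_n) (D : set 'rV[R]_n) (f v g : 'rV[R]_n -> R).

(** The points y are the vertices of a cube centred at 0, chosen with the signs
    of x so that the pairing is the l1 norm. By convexity f is at most
    f 0 + eta at them once the cube is shrunk enough. *)
Lemma norm1_test_points D f (eta : R) :
  convex_function D f -> D° 0 -> 0 < eta ->
  exists2 c, 0 < c & forall x, exists y,
    [/\ D y, pairing x y = c * \sum_i `|x ord0 i| & f y <= f 0 + eta].
Proof.
move=> cf D0 eta0.
have D00 : D 0 by exact: interior_subset.
have /nbhs_ballP[e /= e0 eD] := D0.
pose corner (s : {ffun 'I_n -> bool}) : 'rV[R]_n :=
  \row_i (e / 2 * (if s i then 1 else -1)).
have e20 : 0 < e / 2 by rewrite divr_gt0.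
have Dcorner s k : 0 <= k <= 1 -> D (k *: corner s).
  move=> /andP[k0 k1]; apply: eD; apply/ball_rV => // i.
  rewrite !mxE sub0r normrN normrM (normrM (e / 2)) (ger0_norm k0) (gtr0_norm e20).
  rewrite (_ : `|if s i then 1 else -1| = 1); last first.
    by case: ifP; rewrite ?normrN normr1.
  by rewrite mulr1; have := ler_wpM2r (ltW e20) k1; lra.
have Dcorner1 s : D (corner s).
  by rewrite -[corner s]scale1r; apply: Dcorner; rewrite ler01 lexx.
pose M := `|f 0| + \sum_s `|f (corner s)|.
have fM s : f (corner s) <= M.
  apply: (le_trans (ler_norm _)); rewrite /M (bigD1 s)//= addrCA lerDl.
  by rewrite addr_ge0// sumr_ge0.
have M0 : 0 <= M - f 0.
  rewrite subr_ge0; apply: (le_trans (ler_norm _)); rewrite lerDl.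
  by rewrite sumr_ge0.
(* A ratio 0 < l < 1 for which l (M - f 0) <= eta. *)
pose l := eta / (eta + (M - f 0) + 1).
have den0 : 0 < eta + (M - f 0) + 1 by rewrite ltr_wpDl// addr_ge0// ltW.
have l0 : 0 < l by rewrite divr_gt0.
have l1 : 0 < 1 - l by rewrite subr_gt0 ltr_pdivrMr// mul1r; lra.
have lM : l * (M - f 0) <= eta.
  by rewrite /l mulrAC ler_pdivrMr// ler_pM2l//; lra.
exists (l * (e / 2)); first by rewrite mulr_gt0.
move=> x; pose s : {ffun 'I_n -> bool} := [ffun i => 0 <= x ord0 i].
have l1E : l + (1 - l) = 1 by rewrite addrC subrK.
exists (l *: corner s); split.
- by apply: Dcorner; apply/andP; split; [exact: ltW|lra].
- rewrite pairingZr -(mulrA l (e / 2)); congr (_ * _).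
  rewrite mulr_sumr; apply: eq_bigr => i _.
  rewrite !mxE ffunE; case: ifPn => [h|]; first by rewrite ger0_norm// mulr1 mulrC.
  by rewrite -ltNge => h; rewrite ltr0_norm// mulrN1 !mulrN mulrC.
- have := convex_fun_comb cf (Dcorner1 s) D00 l0 l1.
  rewrite l1E !divr1 scaler0 addr0 => /le_trans; apply.
  by have := ler_wpM2l (ltW l0) (fM s); lra.
Qed.

(** With a a subgradient of f at 0, g is at most
    sup_(y in D) pairing (x - t a) y - t f 0 + k, and the supremum is bounded
    for x in the unit cube at t a. *)
Lemma ray_integral_ge D v f (B k : R) :
  convex_set D -> convex_function D f -> D° 0 ->
  (forall y, D y -> forall i, `|y ord0 i| <= B) ->
  (forall y, D y -> - k <= v y) ->
  exists C, forall t g, 0 <= t ->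
    (forall x, (g x)%:E = legendre D (fun y => (v y + t * f y)%:E) x) ->
    ((expR (t * f 0 - C))%:E <=
      \int[lebesgue_rV R n]_x (expR (- g x))%:E)%E.
Proof.
move=> cD cf D0 hB vk.
have [a ha] := subgradient cD cf D0.
exists (n%:R * (B * 1) + k) => t g t0 gE.
rewrite -[t * f 0 - _]opprK; apply: (@integral_expRN_ge _ _ _ (t *: a)).
  exact: measurable_fin_legendre gE.
move=> x hx; rewrite -lee_fin gE.
apply: (@legendre_le _ _ _ _ (fun y => v y + t * f y)) => // y Dy.
have h1 := vk y Dy.
have h2 : t * (f 0 + pairing a y) <= t * f y.
  by apply: ler_wpM2l => //; have := ha y Dy; rewrite subr0.
have : `|pairing y (x - t *: a)| <= n%:R * (B * 1).
  apply: pairing_bound => i; first exact: hB.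
  have := hx i; rewrite !mxE => /andP[? ?].
  by rewrite ler_norml; apply/andP; split; lra.
rewrite pairingBr pairingZr (pairingC y x) (pairingC y a) => /ler_normlP[_ h3].
lra.
Qed.

Lemma ray_integral_le D v f (C eta : R) :
  convex_function D f -> D° 0 -> (forall y, D y -> v y <= C) -> 0 < eta ->
  exists C', forall t g, 0 <= t ->
    (forall x, (g x)%:E = legendre D (fun y => (v y + t * f y)%:E) x) ->
    (\int[lebesgue_rV R n]_x (expR (- g x))%:E <=
      (expR (t * (f 0 + eta) + C'))%:E)%E.
Proof.
move=> cf D0 vC eta0; have [c c0 hc] := norm1_test_points cf D0 eta0.
have Kfin := integral_expR_norm1 n c0.
set K := (\int[_]_x _)%E in Kfin.
have K0 : (0 <= K)%E by apply: integral_ge0 => x _; rewrite lee_fin expR_ge0.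
have KE : K = (fine K)%:E by rewrite fineK// ge0_fin_numE.
exists (C + fine K) => t g t0 gE.
apply: le_trans (integral_expRN_le (c := c) (k := C + t * (f 0 + eta))
  (measurable_fin_legendre gE) _) _.
  move=> x; have [y [Dy yE fy]] := hc x.
  have : ((pairing x y - (v y + t * f y))%:E <= (g x)%:E)%E.
    by rewrite gE; exact: legendre_ge.
  by rewrite lee_fin yE; have := ler_wpM2l t0 fy; have := vC y Dy; lra.
rewrite -/K KE -EFinM lee_fin addrA (addrC _ C) (expRD (C + _)).
rewrite ler_wpM2l ?expR_ge0//.
(* The factor K is absorbed into the exponent, as K <= exp K. *)
by apply: le_trans (expR_ge1Dx _); rewrite lerDr.
Qed.

End ray_integral.

(** * The slope of the Ding functional *)

Section slope.
Context {R : realType}.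

Lemma slope_limit (a b v c : R) (j : R -> R) :
  (exists C1, forall t, 0 <= t -> t * a - C1 <= j t) ->
  (forall eta, 0 < eta ->
    exists C2, forall t, 0 <= t -> j t <= t * (a + eta) + C2) ->
  t^-1 * (v * (c + t * b) - j t) @[t --> +oo] --> - a + v * b.
Proof.
move=> [C1 hC1] hC2; apply/cvgrPdist_le => e e0.
have e20 : 0 < e / 2 by rewrite divr_gt0.
have [C2 {}hC2] := hC2 _ e20.
pose S := `|v * c| + `|C1| + `|C2|.
near=> t.
have t0 : 0 < t by near: t; apply: nbhs_pinfty_gt; exact: num_real.
have tS : 2 * S / e <= t by near: t; apply: nbhs_pinfty_ge; exact: num_real.
have tS' : S <= t * (e / 2).
  by move: tS; rewrite ler_pdivrMr// => ?; lra.
have -> : - a + v * b - t^-1 * (v * (c + t * b) - j t) =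
   (j t - t * a - v * c) / t by field; rewrite gt_eqF.
rewrite normrM normfV (gtr0_norm t0) ler_pdivrMr// ler_norml.
have := hC1 t (ltW t0); have := hC2 t (ltW t0).
have := ler_norm (v * c); have := ler_norm (- (v * c)).
have := ler_norm C1; have := ler_norm C2.
have := normr_ge0 (v * c); have := normr_ge0 C1; have := normr_ge0 C2.
rewrite normrN; move: tS'; rewrite /S.
have : 0 < t * (e / 2) by rewrite mulr_gt0.
by move=> *; apply/andP; split; lra.
Unshelve. all: by end_near. Qed.

End slope.

Theorem theorem1 (R : realType) (n : nat) (P : set 'rV[R]_n)
  (hP : exists2 Q : set 'rV[R]_n, fano_polytope Q & P = dual_polytope Q)
  (phi0 : 'rV[R]_n -> R) (hphi0 : PSHb P phi0)
  (f : 'rV[R]_n -> R)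
  (hf_convex : convex_function P° f)
  (hf_L1 : (lebesgue_rV R n).-integrable P° (EFin \o f))
  (phi : R -> 'rV[R]_n -> R)
  (hphi : forall t x, 0 <= t -> (phi t x)%:E = toric_ray P phi0 f t x)
  (hE1 : forall t, 0 <= t -> finite_energy P (phi t)) :
  ((t^-1)%:E * ding P (phi t))%E @[t --> +oo] -->
  (- f 0 + (volume P)^-1 * \int[lebesgue_rV R n]_(y in P°) f y)%:E.
Proof.
have [Q [polyQ _ _] PE] := hP.
have fW : finite_set (vertex Q) by exact: finite_vertex.
have intE : P° = strict_polar (vertex Q) by rewrite PE interior_polar.
have mP : measurable P by rewrite PE; exact: measurable_polar.
have oI : open P° by exact: open_interior.
have mI : measurable P° by exact: open_measurable_rV.
have IP : P° `<=` P by exact: interior_subset.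
have cI : convex_set P° by rewrite intE; exact: convex_strict_polar.
have II0 : P°° 0.
  move: oI; rewrite openE; apply.
  by rewrite intE => q _; rewrite pairing0r add0r.
have dP : (lebesgue_rV R n).-negligible (P `\` P°).
  by rewrite intE PE; exact: polar_boundary_null.
have [_ [C hC]] := hphi0.
have [B hB] := support_finite_bounded hC.
have Ifin : (lebesgue_rV R n P° < +oo)%E.
  by apply: (@bounded_finite_measure R n P° B) => // y /IP; exact: hB.
pose v y := fine (conjugate phi0 y).
have vE y : P° y -> conjugate phi0 y = (v y)%:E.
  move=> /IP Py; have /andP[h1 h2] := conjugate_bounded hC Py.
  rewrite /v fineK// fin_numE; apply/andP; split.
    by rewrite gt_eqF// (lt_le_trans _ h1)// ltNyr.
  by rewrite lt_eqF// (le_lt_trans h2)// ltry.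
have v_ge y : P° y -> - phi0 0 <= v y.
  by move=> Iy; have := conjugate_bounded hC (IP _ Iy); rewrite vE// !lee_fin => /andP[].
have v_le y : P° y -> v y <= C.
  by move=> Iy; have := conjugate_bounded hC (IP _ Iy); rewrite vE// !lee_fin => /andP[].
have cv : convex_function P° v by apply: (convex_legendre _ vE cI).
have cu t : 0 <= t -> convex_function P° (fun y => v y + t * f y).
  move=> t0 s x y xI yI; have := cv s x y xI yI; have := hf_convex s x y xI yI.
  by rewrite !convRE /= => /(ler_wpM2l t0); lra.
have phiE t x : 0 <= t ->
    (phi t x)%:E = legendre P° (fun y => (v y + t * f y)%:E) x.
  move=> t0; rewrite hphi// /toric_ray /legendre; congr ereal_sup.
  by apply: eq_imagel => y Iy /=; rewrite vE.
have iv : (lebesgue_rV R n).-integrable P° (EFin \o v).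
  apply: measurable_bounded_integrable => //.
    apply: measurable_funTS; apply: measurableT_comp => //.
    exact: measurable_legendre.
  exists (`|phi0 0| + `|C|); split; first exact: num_real.
  move=> M hM y Iy; have := v_ge y Iy; have := v_le y Iy.
  have := ler_norm (phi0 0); have := ler_norm C.
  have := normr_ge0 (phi0 0); have := normr_ge0 C.
  by rewrite /= ler_norml => *; apply/andP; split; lra.
pose Iv := \int[lebesgue_rV R n]_(y in P°) v y.
pose If := \int[lebesgue_rV R n]_(y in P°) f y.
have energyE t : 0 <= t ->
    (\int[lebesgue_rV R n]_(y in P) conjugate (phi t) y = (Iv + t * If)%:E)%E.
  move=> t0; rewrite (integral_setD_null mI mP IP) //; last first.
    by apply: measurable_funTS; exact: measurable_legendre.
  have phiD y : P° y -> conjugate (phi t) y = (v y + t * f y)%:E.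
    apply: (@biconjugate R n P° (fun y => v y + t * f y)) => //; first exact: cu.
    by move=> x; exact: phiE.
  under eq_integral => y do [rewrite inE => Iy; rewrite phiD// EFinD EFinM].
  rewrite integralD//; last exact: integrableZl.
  rewrite integralZl// EFinD EFinM /Iv /If /Rintegral !fineK//.
    exact: (integrable_fin_num mI hf_L1).
  exact: (integrable_fin_num mI iv).
pose J t := (\int[lebesgue_rV R n]_x (expR (- phi t x))%:E)%E.
have J_ge : exists C1, forall t, 0 <= t -> ((expR (t * f 0 - C1))%:E <= J t)%E.
  have [|C1 hC1] := @ray_integral_ge R n P° v f B (phi0 0) cI hf_convex II0 _ v_ge.
    by move=> y /IP; exact: hB.
  by exists C1 => t t0; apply: hC1 => // x; exact: phiE.
have J_le eta : 0 < eta -> exists C2, forall t, 0 <= t ->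
    (J t <= (expR (t * (f 0 + eta) + C2))%:E)%E.
  move=> /(ray_integral_le hf_convex II0 v_le)[C2 hC2].
  by exists C2 => t t0; apply: hC2 => // x; exact: phiE.
pose j t := ln (fine (J t)).
have [C1 hC1] := J_ge.
have JE t : 0 <= t -> 0 < fine (J t) /\ J t = (fine (J t))%:E.
  move=> t0; have [C2 /(_ t t0) hC2] := J_le 1 ltr01.
  have Jpos : (0 < J t)%E by apply: lt_le_trans (hC1 t t0); rewrite lte_fin expR_gt0.
  have JE : J t = (fine (J t))%:E.
    by rewrite fineK// ge0_fin_numE ?ltW// (le_lt_trans hC2)// ltry.
  by split => //; rewrite -lte_fin -JE.
have dingE t : 0 <= t ->
    ding P (phi t) = ((volume P)^-1 * (Iv + t * If) - j t)%:E.
  move=> t0; have [J0 Jt] := JE t t0.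
  by rewrite /ding energyE// -/(J t) Jt lne_EFin// EFinB EFinM.
apply: cvg_EFin.
  near=> t; have t0 : 0 <= t by near: t; apply: nbhs_pinfty_ge; exact: num_real.
  by rewrite dingE.
apply: cvg_trans; last apply: (@slope_limit R (f 0) If (volume P)^-1 Iv j).
- apply: near_eq_cvg; near=> t.
  have t0 : 0 <= t by near: t; apply: nbhs_pinfty_ge; exact: num_real.
  by rewrite /= dingE.
- exists C1 => t t0; have [J0 Jt] := JE t t0.
  by rewrite -ler_expR lnK ?posrE// -lee_fin -Jt; exact: hC1.
- move=> eta /J_le[C2 hC2]; exists C2 => t t0; have [J0 Jt] := JE t t0.
  by rewrite -ler_expR lnK ?posrE// -lee_fin -Jt; exact: hC2.
Unshelve. all: by end_near. Qed.
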